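(* Let $u,v$ be permutations with separated descents, i.e. there is an integer $k$ with $\mathrm{maxdes}(u)\le k\le\mathrm{mindes}(v)$, and let $w\in S_\infty$ be arbitrary. Then the polynomial $\partial_{w/v}\mathfrak{S}_u(x)$ has nonnegative integer coefficients: $$\partial_{w/v}\mathfrak{S}_u(x)\in\mathbb{Z}_{\ge 0}[x_1,x_2,\ldots].$$
   Context: $S_n$ is the group of permutations of $\{1,\ldots,n\}$, $S_\infty=\bigcup_n S_n$, $s_i=(i,i+1)$. $\mathrm{maxdes}(u)=\max\{i: u(i)>u(i+1)\}$, $\mathrm{mindes}(v)=\min\{i: v(i)>v(i+1)\}$, with $\mathrm{maxdes}(\mathrm{id})=0$, $\mathrm{mindes}(\mathrm{id})=+\infty$. The divided difference operators are $\partial_i f=\dfrac{f-f|_{x_i\leftrightarrow x_{i+1}}}{x_i-x_{i+1}}$, and $\partial_w=\partial_{i_1}\cdots\partial_{i_\ell}$ for any reduced decomposition $w=s_{i_1}\cdots s_{i_\ell}$. The skew operators $\partial_{w/v}$ ($v,w\in S_\infty$) are the linear operators on polynomials in $x_1,x_2,\ldots$ characterized by $$\partial_w(fg)=\sum_{v}(\partial_{w/v}f)(\partial_v g)\quad\text{for all polynomials } f,g.$$ The single Schubert polynomials $\mathfrak{S}_w(x)$, $w\in S_\infty$, are determined by $\mathfrak{S}_{n\cdots 21}(x)=\prod_{i+j\le n}x_i$ (product over positive integers $i,j$) for all $n$, and $\partial_i\mathfrak{S}_w(x)=\mathfrak{S}_{ws_i}(x)$ whenever $w(i)>w(i+1)$.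 *)

(* Defs.v *)
From HB Require Import structures.
From mathcomp Require Import all_boot all_order all_algebra.
From mathcomp Require Import finmap.
From mathcomp Require Import boolp classical_sets fsbigop.
From mathcomp Require Import monalg.
From mathcomp Require Import zify ring.

Set Implicit Arguments.
Unset Strict Implicit.
Unset Printing Implicit Defensive.

Import GRing.Theory Num.Theory.

Local Open Scope ring_scope.

(* Indices are shifted by one: the natural number [i] stands for the positive
   integer [i.+1].  Thus ['x_ i] is the variable $x_{i+1}$, [w i = j] means
   $w(i+1) = j+1$, and [sgen i] is the transposition $s_{i+1}$.  Only the
   positions of descents ([descents], [maxdes], [mindes]) are reported in the
   original, 1-based, numbering. *)

(* -------------------------------------------------------------------- *)
(* Bijections of a set with finite support are the same thing as injections
   with finite support, so [Sinf] is the group $S_\infty = \bigcup_n S_n$. *)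

Record Sinf : Type := MkSinf {
  sinf_fun :> {fsfun nat -> nat of x => x};
  sinf_inj : fsinjectiveb sinf_fun }.

HB.instance Definition _ := [isSub for sinf_fun].
HB.instance Definition _ := [Choice of Sinf by <:].

Lemma sinfP (u v : Sinf) : u =1 v -> u = v.
Proof. by move=> uv; apply/val_inj/fsfunP. Qed.

Lemma sinf_injective (u : Sinf) : injective u.
Proof. exact/fsinjectiveP/sinf_inj. Qed.

Lemma fsinjectiveb_id : fsinjectiveb ([fsfun] : {fsfun nat -> nat of x => x}).
Proof. by apply/fsinjectiveP => i j; rewrite !fsfun0E. Qed.

Definition sid : Sinf := MkSinf fsinjectiveb_id.

Lemma fsinjectiveb_comp (u v : Sinf) : fsinjectiveb (fsfun_comp u v).
Proof.
by apply/fsinjectiveP/fscomp_inj; apply: sinf_injective.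
Qed.

(* (u * v)(i) = u(v(i)) *)
Definition smul (u v : Sinf) : Sinf := MkSinf (fsinjectiveb_comp u v).

Lemma sidE i : sid i = i.
Proof. exact: fsfun0E. Qed.

Lemma smulE u v i : smul u v i = u (v i).
Proof. exact: fscompE. Qed.

Definition swapn (i j : nat) : nat :=
  if j == i then i.+1 else if j == i.+1 then i else j.

Lemma swapnK i : involutive (swapn i).
Proof.
move=> j; rewrite /swapn; case: (j =P i) => ?; case: (j =P i.+1) => ?;
by do 2?[case: eqP => ?]; lia.
Qed.

Lemma swapn_gt i j : (i.+1 < j)%N -> swapn i j = j.
Proof. by rewrite /swapn; case: (j =P i) => ?; case: (j =P i.+1) => ?; lia. Qed.

Definition sgen_fun (i : nat) : {fsfun nat -> nat of x => x} :=
  [fsfun j in [fset i; i.+1]%fset => swapn i j].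

Lemma sgen_funE i : sgen_fun i =1 swapn i.
Proof.
move=> j; rewrite fsfun_fun !inE /swapn.
by case: (j == i); case: (j == i.+1).
Qed.

Lemma sgen_fun_inj i : fsinjectiveb (sgen_fun i).
Proof.
apply/fsinjectiveP => j k; rewrite !sgen_funE.
exact: (can_inj (swapnK i)).
Qed.

Definition sgen (i : nat) : Sinf := MkSinf (sgen_fun_inj i).

Lemma sgenE i j : sgen i j = swapn i j.
Proof. exact: sgen_funE. Qed.

(* The permutation n ... 2 1 of S_n. *)
Definition slong_fun (n : nat) : {fsfun nat -> nat of x => x} :=
  [fsfun j in [fset j in iota 0 n]%fset => (n.-1 - j)%N].

Lemma slong_funE n j :
  slong_fun n j = if (j < n)%N then (n.-1 - j)%N else j.
Proof. by rewrite fsfun_fun !inE mem_iota. Qed.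

Lemma slong_fun_inj n : fsinjectiveb (slong_fun n).
Proof.
by apply/fsinjectiveP => j k; rewrite !slong_funE; do 2!case: ltnP => ?; lia.
Qed.

Definition slong (n : nat) : Sinf := MkSinf (slong_fun_inj n).

(* w fixes every i >= sbound w *)
Definition sbound (w : Sinf) : nat := (\max_(i <- finsupp w) i.+1)%N.

Lemma sbound_fix (w : Sinf) i : (sbound w <= i)%N -> w i = i.
Proof.
move=> le_wi; apply: fsfun_dflt; apply/negP => iw.
have: (i.+1 <= sbound w)%N by rewrite /sbound (big_fsetD1 i) //= leq_maxl.
lia.
Qed.

(* The increasing list of all descents {i >= 1 : w(i) > w(i+1)}. *)
Definition descents (w : Sinf) : seq nat :=
  [seq i.+1 | i <- iota 0 (sbound w) & (w i.+1 < w i)%N].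

Lemma mem_descents (w : Sinf) i :
  (i \in descents w) = (0 < i)%N && (w i < w i.-1)%N.
Proof.
apply/mapP/andP => [[j]|[]].
  by rewrite mem_filter => /andP[wj _] ->.
case: i => // i _ /= wi; exists i => //; rewrite mem_filter wi mem_iota /=.
rewrite add0n ltnNge; apply/negP => le_wi; move: wi.
by rewrite !sbound_fix ?(leqW le_wi) //; lia.
Qed.

Definition maxdes (w : Sinf) : nat := (\max_(i <- descents w) i)%N.

(* [None] stands for $+\infty$, the value at the identity. *)
Definition mindes (w : Sinf) : option nat := ohead (descents w).

Definition le_mindes (k : nat) (w : Sinf) : bool :=
  if mindes w is Some d then (k <= d)%N else true.

(* As maxdes u >= 0, the integer k is necessarily a natural number. *)
Definition separated_descents (u v : Sinf) : Prop :=
  exists k : nat, (maxdes u <= k)%N /\ le_mindes k v.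

(* -------------------------------------------------------------------- *)
(* The ring Z[x_1, x_2, ...]. *)

Notation polyZ := {malg int[{cmonom nat}]}.

HB.lock Definition pvar (i : nat) : polyZ := << ucm i >>.
Notation "''x_' i" := (pvar i)
  (at level 8, i at level 2, format "''x_' i") : ring_scope.

Lemma pvarE i : 'x_i = << ucm i >>.
Proof. by rewrite pvar.unlock. Qed.

Definition mon_subst (g : nat -> polyZ) (m : {cmonom nat}) : polyZ :=
  \prod_(j <- finsupp m) g j ^+ m j.

Lemma mon_substEw g (m : {cmonom nat}) (d : {fset nat}) :
  (finsupp m `<=` d)%fset -> mon_subst g m = \prod_(j <- d) g j ^+ m j.
Proof.
move=> le; rewrite /mon_subst (big_fset_incl _ le) // => j _.
by rewrite -cmE_eq0 => /eqP ->; rewrite expr0.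
Qed.

Lemma mon_subst_is_mmorphism g : mmorphism (mon_subst g).
Proof.
split=> [m1 m2|]; last by rewrite /mon_subst mdom1 big_seq_fset0.
rewrite {1}/mon_subst mdomD.
rewrite (mon_substEw g (fsubsetUl _ (finsupp m2))).
rewrite (mon_substEw g (fsubsetUr (finsupp m1) _)).
by rewrite -big_split /=; apply: eq_bigr => j _; rewrite cmM exprD.
Qed.

HB.instance Definition _ g :=
  isMultiplicative.Build {cmonom nat} polyZ (mon_subst g)
    (mon_subst_is_mmorphism g).

(* f with x_{i+1} and x_{i+2} exchanged *)
Definition swapX (i : nat) : polyZ -> polyZ :=
  mmap (@malgC {cmonom nat} int) (mon_subst (fun j => 'x_(swapn i j))).

HB.instance Definition _ i := GRing.RMorphism.on (swapX i).

Lemma polyZ_ind (P : polyZ -> Prop) :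
    (forall c, P c%:MP) -> (forall i, P 'x_i) ->
    (forall f g, P f -> P g -> P (f + g)) ->
    (forall f g, P f -> P g -> P (f * g)) ->
  forall f, P f.
Proof.
move=> PC PX PD PM f; rewrite (monalgE f).
elim/big_ind: _ => [|//|m _]; first by have := PC 0; rewrite monalgU0.
suff Pm : P << m >>.
  have -> : << f@_m *g m >> = (f@_m)%:MP * << m >> :> polyZ.
    by rewrite malgM_def fgmulUU mulr1 mul1m.
  exact: (PM _ _ (PC _) Pm).
have [n] := ubnP (mdeg m); elim: n m => // n IHn m le_mn.
have [/mdeg_eq0I ->|] := eqVneq (mdeg m) 0%N; first exact: PC.
rewrite mdegE => nz_m; have [i mi] : exists i, m i != 0%N.
  apply/not_existsP => m0; move: nz_m; rewrite big1 // => i _.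
  by apply/eqP/negPn/negP/m0.
have mE : m = mmul (ucm i) (divcm m (ucm i)).
  apply/eqP/cmP => j; rewrite cmM divcmE cmU.
  by case: eqVneq => [<-|_] /=; rewrite ?subn0 // subnKC // lt0n.
have -> : << m >> = 'x_i * << divcm m (ucm i) >> :> polyZ.
  by rewrite pvarE malgM_def fgmulUU mulr1 -mE.
apply: (PM _ _ (PX i)); apply: IHn.
by move: (congr1 mdeg mE); rewrite mdegM mdegU; lia.
Qed.

Lemma swapXC i c : swapX i c%:MP = c%:MP.
Proof. exact: mmapC. Qed.

Lemma swapX_var i j : swapX i 'x_j = 'x_(swapn i j).
Proof.
rewrite /swapX [in LHS](pvarE j) mmapU mul1r /=.
by rewrite /mon_subst mdomU big_seq_fset1 cmUU expr1.
Qed.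

Lemma swapXD i f g : swapX i (f + g) = swapX i f + swapX i g.
Proof. exact: rmorphD. Qed.

Lemma swapXM i f g : swapX i (f * g) = swapX i f * swapX i g.
Proof. exact: rmorphM. Qed.

Lemma twisted_leibniz (R : comNzRingType) (d a a' sa b b' sb : R) :
    d * a' = a - sa -> d * b' = b - sb ->
  d * (a' * b + sa * b') = a * b - sa * sb.
Proof. by move=> aE bE; rewrite mulrDr mulrA aE mulrCA bE; ring. Qed.

Lemma ddiff_ex i (f : polyZ) :
  exists g, ('x_i - 'x_(i.+1)) * g == f - swapX i f.
Proof.
elim/polyZ_ind: f
  => [c|j|f g [f' /eqP fE] [g' /eqP gE]|f g [f' /eqP fE] [g' /eqP gE]].
- by exists 0; rewrite swapXC subrr mulr0 eqxx.
- rewrite swapX_var /swapn; case: eqP => [->|_]; last case: eqP => [->|_].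
  + by exists 1; rewrite mulr1 eqxx.
  + by exists (-1); rewrite mulrN1 opprB eqxx.
  + by exists 0; rewrite mulr0 subrr eqxx.
- by exists (f' + g'); rewrite mulrDr fE gE swapXD opprD addrACA eqxx.
- exists (f' * g + swapX i f * g').
  by apply/eqP; rewrite swapXM; exact: (twisted_leibniz fE gE).
Qed.

(* The divided difference (f - s_i f) / (x_i - x_{i+1}). *)
Definition ddiff (i : nat) (f : polyZ) : polyZ := xchoose (ddiff_ex i f).

Lemma ddiffE i f : ('x_i - 'x_(i.+1)) * ddiff i f = f - swapX i f.
Proof. exact/eqP/(xchooseP (ddiff_ex i f)). Qed.

Lemma mcoeff_varM i g (k : {cmonom nat}) :
  ('x_i * g)@_k = if k i == 0%N then 0 else g@_(divcm k (ucm i)).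
Proof.
rewrite pvarE malgM_def fgmulUg raddf_sum /=.
have [ki|ki] := eqVneq (k i) 0%N.
  rewrite big1 // => m _; rewrite mcoeffU; case: eqP => // kE.
  by move: ki; rewrite -kE cmM cmUU.
have eqk m : (mmul (ucm i) m == k) = (m == divcm k (ucm i)).
  apply/cmP/cmP => [mE j|mE j].
    by rewrite divcmE -mE cmM cmU; lia.
  rewrite cmM mE divcmE cmU.
  by case: eqVneq => [<-|_] /=; rewrite ?subn0 // subnKC // lt0n.
under eq_bigr do rewrite mcoeffU mul1r eqk.
have [kg|kg] := msuppP g (divcm k (ucm i)).
  rewrite (big_fsetD1 _ kg) /= eqxx big1_fset ?addr0 // => m.
  by rewrite in_fsetD1 => /andP[/negPf -> _]; rewrite mulr0n.
rewrite big1_fset // => m mg _; case: eqP => // mE.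
by rewrite -mE mg in kg.
Qed.

Lemma pvarB_reg i (h : polyZ) : ('x_i - 'x_(i.+1)) * h = 0 -> h = 0.
Proof.
move=> h0; apply/malgP => m; rewrite mcoeff0.
have hE k : ('x_i * h)@_k = ('x_(i.+1) * h)@_k.
  by apply: subr0_eq; rewrite -mcoeffB -mulrBl h0 mcoeff0.
have {}hE (k : {cmonom nat}) : (if k i == 0%N then 0 else h@_(divcm k (ucm i)))
            = if k i.+1 == 0%N then 0 else h@_(divcm k (ucm i.+1)).
  exact: etrans (etrans (esym (mcoeff_varM i h k)) (hE k)) (mcoeff_varM _ h k).
have [n] := ubnP (m i); elim: n m => // n IHn m le_mn.
have := hE (mmul m (ucm i.+1)); rewrite !cmM !cmU eqxx.
have -> : divcm (mmul m (ucm i.+1)) (ucm i.+1) = m.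
  by apply/eqP/cmP => j; rewrite divcmE cmM addnK.
have ne_i : (i.+1 == i) = false by lia.
rewrite ne_i addn0 addn1 /= => <-; case: eqP => // /eqP mi.
apply: IHn; rewrite divcmE cmM !cmU eqxx ne_i; move: mi le_mn.
by rewrite -lt0n; case: (m i) => // k _; rewrite addn0 subn1.
Qed.

Lemma ddiff_uniq i f g :
  ('x_i - 'x_(i.+1)) * g = f - swapX i f -> g = ddiff i f.
Proof.
move=> gE; apply: subr0_eq; apply: (@pvarB_reg i).
by rewrite mulrBr gE ddiffE subrr.
Qed.

(* -------------------------------------------------------------------- *)
Definition word_prod (a : seq nat) : Sinf :=
  foldr (fun i w => smul (sgen i) w) sid a.

Definition reduced_word (a : seq nat) (w : Sinf) : Prop :=
  word_prod a = w /\ (forall b, word_prod b = w -> (size a <= size b)%N).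

Lemma word_prod_surj w : exists a, word_prod a = w.
Proof.
have [N] : exists N, forall j, (N <= j)%N -> w j = j.
  by exists (sbound w) => j; apply: sbound_fix.
elim: N w => [|N IHN] w wfix.
  by exists [::]; apply: sinfP => j; rewrite /= sidE wfix.
have le_wN : (w N <= N)%N.
  rewrite leqNgt; apply/negP => lt_Nw; have := wfix _ lt_Nw.
  by move/sinf_injective; lia.
have [d] := ubnP (N - w N)%N.
elim: d w wfix le_wN => // d IHd w wfix le_wN le_d.
have [wN|ne_wN] := eqVneq (w N) N.
  by apply: IHN => j; rewrite leq_eqVlt => /orP[/eqP <-//|/wfix].
have lt_wN : (w N < N)%N by rewrite ltn_neqAle ne_wN.
have [|||a aE] := IHd (smul (sgen (w N)) w).
- move=> j lt_Nj; rewrite smulE sgenE (wfix _ lt_Nj) swapn_gt //;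
  by apply: leq_ltn_trans lt_Nj.
- by rewrite smulE sgenE /swapn eqxx.
- by rewrite smulE sgenE /swapn eqxx subnS; lia.
exists (w N :: a); rewrite /= aE; apply: sinfP => j.
by rewrite !smulE !sgenE swapnK.
Qed.

Lemma reduced_word_ex w : exists a, reduced_word a w.
Proof.
have [a] := word_prod_surj w; have [n] := ubnP (size a).
elim: n a => // n IHn a le_an aE.
have [[b [bE lt_ba]]|noshort] :=
  pselect (exists b, word_prod b = w /\ (size b < size a)%N).
  by apply: IHn bE; lia.
exists a; split=> // b bE; rewrite leqNgt; apply/negP => lt_ba.
by apply: noshort; exists b.
Qed.

Definition ddword (a : seq nat) (f : polyZ) : polyZ := foldr ddiff f a.

(* The operator d_w, computed from an arbitrarily chosen reduced decomposition
   of w; by the braid relations it does not depend on this choice. *)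
Definition ddperm (w : Sinf) : polyZ -> polyZ :=
  ddword (sval (cid (reduced_word_ex w))).

(* [D w v] is the operator d_{w/v}.  For a given g, only finitely many of the
   polynomials d_v g are nonzero, so that the sum over the infinite group is
   finitely supported. *)
Definition is_skew_ddiff (D : Sinf -> Sinf -> {linear polyZ -> polyZ}) : Prop :=
  forall (w : Sinf) (f g : polyZ),
    ddperm w (f * g) = \sum_(v \in [set: Sinf]%classic) D w v f * ddperm v g.

Definition is_schubert (S : Sinf -> polyZ) : Prop :=
  (forall n : nat, S (slong n) =
     \prod_(i < n) \prod_(j < n | (i.+1 + j.+1 <= n)%N) 'x_i) /\
  (forall (w : Sinf) (i : nat), (w i.+1 < w i)%N ->
     ddiff i (S w) = S (smul w (sgen i))).

(* Main.v *)
Require Import Defs.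
From HB Require Import structures.
From mathcomp Require Import all_boot all_order all_algebra.
From mathcomp Require Import finmap boolp classical_sets fsbigop monalg.
From mathcomp Require Import zify ring.

(* The skew operators satisfy the recursion
     D_{w s_j / v} f = D_{w/v} (d_j f) + [v s_j < v] D_{w / v s_j} (s_j f)
   when w s_j > w, the right-hand side being 0 otherwise, and they multiply like
   matrices: D_{w/v} (f g) = sum_z D_{w/z} f * D_{z/v} g.
   Fix k and let P_k be the set of the polynomials f such that D_{w/v} f has
   nonnegative coefficients for all w and all v increasing on 1, ..., k.
   By the recursion, P_k is stable under d_i for i < k, which reduces the claim
   S_u \in P_k to permutations u that decrease on 1, ..., k and increase after
   k.  These are dominant, so S_u is a monomial x^c with c_1 >= ... >= c_k, that
   is, a product of monomials x_1 ... x_j with j <= k.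
   Finally x_1 ... x_j is in P_j: by Monk's rule a negative term of the product by
   x_j leads to a w with w(l) > w(j) for some l < j, but the coefficient at such
   a w vanishes, because x_1 ... x_j is symmetric. *)

Set Implicit Arguments.
Unset Strict Implicit.
Unset Printing Implicit Defensive.

Import GRing.Theory Num.Theory.
Local Open Scope ring_scope.

Implicit Types u v w : Sinf.

(** * Divided differences *)

(** Conditions whose left side contains an [if] are skipped, so nested [swapn]s are resolved from
    the inside out. *)
Ltac case_eqs :=
  repeat match goal with
  | |- context [@eq_op _ ?a ?b] =>
      lazymatch a with context [if _ then _ else _] => fail | _ => idtac end;
      case: (a =P b) => ?
  end.

Lemma swapnC i j k : (i.+1 < j)%N -> swapn i (swapn j k) = swapn j (swapn i k).
Proof. by move=> lt_ij; rewrite /swapn; case_eqs; lia. Qed.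

Lemma swapn_braid i k :
  swapn i (swapn i.+1 (swapn i k)) = swapn i.+1 (swapn i (swapn i.+1 k)).
Proof. by rewrite /swapn; case_eqs; lia. Qed.

Lemma polyZ_rmorph_eq (F G : {rmorphism polyZ -> polyZ}) :
    (forall c, F c%:MP = G c%:MP) -> (forall i, F 'x_i = G 'x_i) ->
  F =1 G.
Proof.
move=> FGC FGX; elim/polyZ_ind => [//|//|f g Ef Eg|f g Ef Eg].
  by rewrite (rmorphD F) (rmorphD G); exact: congr2 Ef Eg.
by rewrite (rmorphM F) (rmorphM G); exact: congr2 Ef Eg.
Qed.

Lemma swapXK i : involutive (swapX i).
Proof.
apply: (@polyZ_rmorph_eq (swapX i \o swapX i) idfun) => [c|j] /=.
  by rewrite !swapXC.
by rewrite !swapX_var swapnK.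
Qed.

Lemma swapX_comm i j f : (i.+1 < j)%N ->
  swapX i (swapX j f) = swapX j (swapX i f).
Proof.
move=> lt_ij; move: f.
apply: (@polyZ_rmorph_eq (swapX i \o swapX j) (swapX j \o swapX i)) => [c|k] /=.
  by rewrite !swapXC.
by rewrite !swapX_var swapnC.
Qed.

Lemma swapX_braid i f :
  swapX i (swapX i.+1 (swapX i f)) = swapX i.+1 (swapX i (swapX i.+1 f)).
Proof.
move: f; apply: (@polyZ_rmorph_eq (swapX i \o (swapX i.+1 \o swapX i))
  (swapX i.+1 \o (swapX i \o swapX i.+1))) => [c|k] /=.
  by rewrite !swapXC.
by rewrite !swapX_var swapn_braid.
Qed.

(* Stated over an abstract ring so that unification never unfolds the operations
   of [polyZ]. *)
Record dd_calculus (R : comNzRingType) (s : nat -> {rmorphism R -> R})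
    (d : nat -> R -> R) (x : nat -> R) : Prop := DDCalculus {
  dd_sK : forall i, involutive (s i);
  dd_s_comm : forall i j f, (i.+1 < j)%N -> s i (s j f) = s j (s i f);
  dd_s_braid : forall i f,
    s i (s i.+1 (s i f)) = s i.+1 (s i (s i.+1 f));
  dd_sx : forall i j, s i (x j) = x (swapn i j);
  dd_reg : forall i f, (x i - x i.+1) * f = 0 -> f = 0;
  dd_E : forall i f, (x i - x i.+1) * d i f = f - s i f }.

Lemma polyZ_dd_calculus : dd_calculus swapX ddiff pvar.
Proof.
split=> [i|i j f|i f|i j|i f|i f].
- exact: swapXK.
- exact: swapX_comm.
- exact: swapX_braid.
- exact: swapX_var.
- exact: pvarB_reg.
- exact: ddiffE.
Qed.

(** Here [a], [b], [c] stand for $\partial_i f$, $\partial_j f$, $\partial_i\partial_j f$, and [sa]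
    for $s_j a$. Cancelling [d] leaves the equation that characterizes [c] as $\partial_j a$. *)
Lemma commuting_differences (R : comNzRingType) (d e f fi fj fij a sa b sb c : R) :
    d * a = f - fi -> d * sa = fj - fij -> e * b = f - fj ->
    e * sb = fi - fij -> d * c = b - sb ->
  d * (e * c - (a - sa)) = 0.
Proof.
move=> aE saE bE sbE cE.
have -> : d * (e * c - (a - sa)) = e * (d * c) - (d * a - d * sa) by ring.
by rewrite cE mulrBr aE saE bE sbE; ring.
Qed.

(* For [d], [e], [h] equal to $x_i - x_{i+1}$, $x_{i+1} - x_{i+2}$ and
   $x_i - x_{i+2}$, the product $d e h$ turns a triple divided difference into an
   alternating sum over $S_3$. *)
Lemma alternating_sum (R : comNzRingType)
    (d e h f f1 f2 f12 f21 f121 a a2 a12 b b1 c : R) : h = d + e ->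
    d * a = f - f1 -> e * b = a - a2 -> d * c = b - b1 ->
    h * a2 = f2 - f21 -> h * b1 = a - a12 -> e * a12 = f12 - f121 ->
  d * (h * (e * c)) = f - f1 - f2 + f21 + f12 - f121.
Proof.
move=> hE aE bE cE a2E b1E a12E.
have -> : d * (h * (e * c)) = h * (e * (d * c)) by ring.
rewrite cE; have -> : h * (e * (b - b1)) = h * (e * b) - e * (h * b1) by ring.
rewrite bE b1E.
have -> : h * (a - a2) - e * (a - a12) = (h - e) * a - h * a2 + e * a12 by ring.
have -> : h - e = d by rewrite hE addrK.
by rewrite aE a2E a12E; ring.
Qed.

Section DividedDifferences.

Variables (R : comNzRingType) (s : nat -> {rmorphism R -> R}).
Variables (d : nat -> R -> R) (x : nat -> R).
Hypothesis calc : dd_calculus s d x.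

Let sK := dd_sK calc.
Let dE := dd_E calc.
Let reg := dd_reg calc.

Lemma dd_uniq i f g : (x i - x i.+1) * g = f - s i f -> g = d i f.
Proof.
by move=> gE; apply/subr0_eq/(reg (i := i)); rewrite mulrBr gE dE subrr.
Qed.

Lemma sx_l i : s i (x i) = x i.+1.
Proof. by rewrite (dd_sx calc) /swapn eqxx. Qed.

Lemma sx_r i : s i (x i.+1) = x i.
Proof. by rewrite (dd_sx calc) /swapn eqxx gtn_eqF. Qed.

Lemma sx_N i j : j != i -> j != i.+1 -> s i (x j) = x j.
Proof. by rewrite (dd_sx calc) /swapn => /negPf -> /negPf ->. Qed.

Lemma dd_D i f g : d i (f + g) = d i f + d i g.
Proof.
by apply/esym/dd_uniq; rewrite mulrDr !dE rmorphD opprD addrACA.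
Qed.

Lemma dd_M i f g : d i (f * g) = d i f * g + s i f * d i g.
Proof. by apply/esym/dd_uniq; rewrite rmorphM; apply: twisted_leibniz. Qed.

Lemma dd_sym i f : s i f = f -> d i f = 0.
Proof. by move=> sf; apply/esym/dd_uniq; rewrite sf mulr0 subrr. Qed.

Lemma dd_xl i : d i (x i) = 1.
Proof. by apply/esym/dd_uniq; rewrite sx_l mulr1. Qed.

Lemma s_dd i f : s i (d i f) = d i f.
Proof.
apply: dd_uniq; have /(congr1 (s i)) := dE i f.
rewrite rmorphM !rmorphB sK sx_l sx_r => E.
by apply: oppr_inj; rewrite -mulNr !opprB.
Qed.

Lemma dd_dd i f : d i (d i f) = 0.
Proof. exact/dd_sym/s_dd. Qed.

Lemma dd_comm i j f : (i.+1 < j)%N -> d i (d j f) = d j (d i f).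
Proof.
move=> lt_ij; have [[n1 n2] [n3 n4]] :
  (j != i /\ j != i.+1) /\ (j.+1 != i /\ j.+1 != i.+1) by lia.
have [[m1 m2] [m3 m4]] :
  (i != j /\ i != j.+1) /\ (i.+1 != j /\ i.+1 != j.+1) by lia.
apply/dd_uniq/subr0_eq; apply: (@reg i).
have := congr1 (s j) (dE i f).
rewrite rmorphM !rmorphB (sx_N m1 m2) (sx_N m3 m4) => sE.
have := congr1 (s i) (dE j f).
rewrite rmorphM !rmorphB (sx_N n1 n2) (sx_N n3 n4) (dd_s_comm calc) // => sE'.
exact: (commuting_differences (dE i f) sE (dE j f) sE' (dE i (d j f))).
Qed.

Lemma dd_triplel i f :
  (x i - x i.+1) * ((x i - x i.+2) * ((x i.+1 - x i.+2)
    * d i (d i.+1 (d i f)))) =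
  f - s i f - s i.+1 f + s i.+1 (s i f)
    + s i (s i.+1 f) - s i (s i.+1 (s i f)).
Proof.
have [n1 n2] : i.+2 != i /\ i.+2 != i.+1 by lia.
have [n3 n4] : i != i.+1 /\ i != i.+2 by lia.
have s2a := congr1 (s i.+1) (dE i f).
rewrite rmorphM !rmorphB sx_l (sx_N n3 n4) in s2a.
have s1b := congr1 (s i) (dE i.+1 (d i f)).
rewrite rmorphM !rmorphB sx_r (sx_N n1 n2) s_dd in s1b.
have s12a := congr1 (s i) s2a.
rewrite rmorphM !rmorphB sx_l (sx_N n1 n2) in s12a.
apply: (alternating_sum _ (dE i f) (dE i.+1 _) (dE i _) s2a s1b s12a).
by rewrite addrA subrK.
Qed.

Lemma dd_tripler i f :
  (x i.+1 - x i.+2) * ((x i - x i.+2) * ((x i - x i.+1)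
    * d i.+1 (d i (d i.+1 f)))) =
  f - s i.+1 f - s i f + s i (s i.+1 f)
    + s i.+1 (s i f) - s i.+1 (s i (s i.+1 f)).
Proof.
have [n1 n2] : i.+2 != i /\ i.+2 != i.+1 by lia.
have [n3 n4] : i != i.+1 /\ i != i.+2 by lia.
have s1a := congr1 (s i) (dE i.+1 f).
rewrite rmorphM !rmorphB sx_r (sx_N n1 n2) in s1a.
have s2b := congr1 (s i.+1) (dE i (d i.+1 f)).
rewrite rmorphM !rmorphB sx_l (sx_N n3 n4) s_dd in s2b.
have s21a := congr1 (s i.+1) s1a.
rewrite rmorphM !rmorphB sx_r (sx_N n3 n4) in s21a.
apply: (alternating_sum _ (dE i.+1 f) (dE i _) (dE i.+1 _) s1a s2b s21a).
by rewrite [RHS]addrC addrA subrK.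
Qed.

(** [s i.+1] carries [x i - x i.+2] to [x i - x i.+1], which is regular. *)
Lemma reg2 i f : (x i - x i.+2) * f = 0 -> f = 0.
Proof.
have [n3 n4] : i != i.+1 /\ i != i.+2 by lia.
move/(congr1 (s i.+1)).
rewrite rmorphM rmorphB sx_r (sx_N n3 n4) rmorph0.
by move/reg/(congr1 (s i.+1)); rewrite sK rmorph0.
Qed.

(** Multiplied by the Vandermonde product of the three variables, both sides become the same
    alternating sum; the three regular factors then cancel. *)
Lemma dd_braid i f : d i (d i.+1 (d i f)) = d i.+1 (d i (d i.+1 f)).
Proof.
apply/subr0_eq/(reg (i := i.+1))/(reg2 (i := i))/(reg (i := i)).
rewrite 3!mulrBr dd_triplel.
have perm (a b c g : R) : a * (b * (c * g)) = c * (b * (a * g)) by ring.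
by rewrite perm dd_tripler (dd_s_braid calc); ring.
Qed.

End DividedDifferences.

(** * Lehmer codes and lengths *)

Definition nlow (w : Sinf) (i b : nat) : nat :=
  count (fun j => w j < b)%N (iota 0 i).

(* The Lehmer code: as $w$ is a bijection, [code w i] is the number of positions
   to the right of [i] with a value smaller than [w i]. *)
Definition code (w : Sinf) (i : nat) : nat := (w i - nlow w i (w i))%N.

Definition len (w : Sinf) : nat := (\sum_(i < sbound w) code w i)%N.

Lemma smulA : associative smul.
Proof. by move=> u v w; apply: sinfP => i; rewrite !smulE. Qed.

Lemma smul1s : left_id sid smul.
Proof. by move=> w; apply: sinfP => i; rewrite smulE sidE. Qed.

Lemma smuls1 : right_id sid smul.
Proof. by move=> w; apply: sinfP => i; rewrite smulE sidE. Qed.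

Lemma smul_sgenE w i j : smul w (sgen i) j = w (swapn i j).
Proof. by rewrite smulE sgenE. Qed.

Lemma smul_sgenl w i : smul w (sgen i) i = w i.+1.
Proof. by rewrite smul_sgenE /swapn eqxx. Qed.

Lemma smul_sgenr w i : smul w (sgen i) i.+1 = w i.
Proof. by rewrite smul_sgenE /swapn eqxx gtn_eqF. Qed.

Lemma smul_sgenN w i j : j != i -> j != i.+1 -> smul w (sgen i) j = w j.
Proof. by rewrite smul_sgenE /swapn => /negPf -> /negPf ->. Qed.

Lemma smul_sgenK i w : smul (smul w (sgen i)) (sgen i) = w.
Proof. by apply: sinfP => j; rewrite !smul_sgenE swapnK. Qed.

Lemma sinf_neq (w : Sinf) i j : i != j -> w i != w j.
Proof. by rewrite (inj_eq (@sinf_injective w)). Qed.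

Lemma asc_or_desc (w : Sinf) i : (w i < w i.+1)%N \/ (w i.+1 < w i)%N.
Proof. by have := @sinf_neq w i i.+1; lia. Qed.

Lemma nlowS w i b : nlow w i.+1 b = (nlow w i b + (w i < b))%N.
Proof. by rewrite /nlow -addn1 iotaD count_cat /= addn0. Qed.

(** By injectivity, the counted positions have distinct values in an interval of [b - a]
    integers. *)
Lemma count_window (w : Sinf) i a b :
  (count (fun j => a <= w j < b)%N (iota 0 i) <= b - a)%N.
Proof.
rewrite -size_filter -(size_map w) -(size_iota a (b - a)).
apply: uniq_leq_size.
  by rewrite map_inj_uniq ?filter_uniq ?iota_uniq //; apply: sinf_injective.
by move=> y /mapP[j]; rewrite mem_filter mem_iota => /andP[/andP[? ?] _] ->; lia.
Qed.

Lemma nlow_split w i a b : (a <= b)%N ->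
  nlow w i b = (nlow w i a + count (fun j => a <= w j < b)%N (iota 0 i))%N.
Proof.
move=> le_ab; rewrite /nlow; elim: (iota 0 i) => //= j t ->.
by case: ltnP; case: ltnP; case: ltnP; lia.
Qed.

Lemma nlow_le w i b : (nlow w i b <= b)%N.
Proof.
rewrite (@nlow_split w i 0) //.
have -> : nlow w i 0 = 0%N.
  by apply/eqP; rewrite -leqn0 leqNgt -has_count -all_predC; apply/allP.
by have := count_window w i 0 b; rewrite subn0.
Qed.

Lemma codeE w i : w i = (code w i + nlow w i (w i))%N.
Proof. by rewrite subnK // nlow_le. Qed.

(** At the first difference, say [u i < v i], equal codes force [v i - u i] earlier positions to
    have values in the interval from [u i] to [v i - 1]. The value [u i] is taken at [i] itself, so
    there are too few. *)
Lemma code_inj u v : code u =1 code v -> u = v.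
Proof.
have key (u' v' : Sinf) i : (forall j, (j < i)%N -> u' j = v' j) ->
    code u' i = code v' i -> (u' i < v' i)%N -> False.
  move=> eq_lt eq_c lt_uv; have := codeE u' i; have := codeE v' i.
  have -> : nlow v' i (v' i) = nlow u' i (v' i).
    by apply: eq_in_count => j; rewrite mem_iota => /eq_lt ->.
  rewrite (nlow_split _ _ (ltnW lt_uv)).
  suff -> : count (fun j => u' i <= u' j < v' i)%N (iota 0 i) =
      count (fun j => (u' i).+1 <= u' j < v' i)%N (iota 0 i).
    by have := count_window u' i (u' i).+1 (v' i); lia.
  apply: eq_in_count => j; rewrite mem_iota => lt_ji.
  by have := @sinf_neq u' i j; lia.
move=> eq_c; apply: sinfP => i; have [n] := ubnP i; elim: n i => // n IHn i lt_in.
have eq_lt j : (j < i)%N -> u j = v j by move=> lt_ji; apply: IHn; lia.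
case: (ltngtP (u i) (v i)) => // [lt_uv|lt_vu]; exfalso.
  exact: (key u v i).
by apply: (key v u i) => // j /eq_lt.
Qed.

Lemma code_ge w i : (sbound w <= i)%N -> code w i = 0%N.
Proof.
move=> le_wi; rewrite /code sbound_fix //.
suff -> : nlow w i i = i by rewrite subnn.
rewrite /nlow -[RHS](size_iota 0) -(count_predT (iota 0 i)).
apply: eq_in_count => j; rewrite mem_iota /= => lt_ji.
rewrite ltnNge; apply/negP => le_iwj.
have /sinf_injective : w (w j) = w j by apply: sbound_fix; lia.
by lia.
Qed.

Lemma code_asc w i : (w i < w i.+1)%N -> (code w i <= code w i.+1)%N.
Proof.
move=> lt_w; have := codeE w i; have := codeE w i.+1.
rewrite nlowS (nlow_split _ _ (ltnW lt_w)) lt_w.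
suff -> : count (fun j => w i <= w j < w i.+1)%N (iota 0 i) =
    count (fun j => (w i).+1 <= w j < w i.+1)%N (iota 0 i).
  by have := count_window w i (w i).+1 (w i.+1); lia.
apply: eq_in_count => j; rewrite mem_iota => lt_ji.
by have := @sinf_neq w i j; lia.
Qed.

Lemma nlow_sgen_le w i j b : (j <= i)%N ->
  nlow (smul w (sgen i)) j b = nlow w j b.
Proof.
move=> le_ji; apply: eq_in_count => k; rewrite mem_iota => lt_kj.
by rewrite smul_sgenN //; lia.
Qed.

Lemma nlow_sgen_gt w i j b : (i.+1 < j)%N ->
  nlow (smul w (sgen i)) j b = nlow w j b.
Proof.
elim: j => // j IHj; rewrite ltnS leq_eqVlt => /orP[/eqP <-|lt_ij].
  by rewrite !nlowS nlow_sgen_le // smul_sgenl smul_sgenr addnAC.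
by rewrite !nlowS IHj // smul_sgenN //; lia.
Qed.

Lemma code_sgenN w i j : j != i -> j != i.+1 ->
  code (smul w (sgen i)) j = code w j.
Proof.
move=> ne1 ne2; rewrite /code smul_sgenN //.
have [le_ji|lt_ij] := leqP j i; first by rewrite nlow_sgen_le.
by rewrite nlow_sgen_gt //; lia.
Qed.

Lemma code_sgenl w i : (w i < w i.+1)%N ->
  code (smul w (sgen i)) i = (code w i.+1).+1.
Proof.
move=> lt_w; rewrite /code smul_sgenl nlow_sgen_le // nlowS lt_w.
by have := nlow_le w i.+1 (w i.+1); rewrite nlowS lt_w; lia.
Qed.

Lemma code_sgenr w i : (w i < w i.+1)%N -> code (smul w (sgen i)) i.+1 = code w i.
Proof.
move=> lt_w; rewrite /code smul_sgenr nlowS nlow_sgen_le // smul_sgenl.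
by rewrite ltnNge (ltnW lt_w) addn0.
Qed.

Lemma code_desc w i : (w i.+1 < w i)%N -> (code w i.+1 < code w i)%N.
Proof.
move=> lt_w; rewrite -(smul_sgenK i w).
have lt_w' : (smul w (sgen i) i < smul w (sgen i) i.+1)%N.
  by rewrite smul_sgenl smul_sgenr.
by rewrite code_sgenl // code_sgenr // ltnS code_asc.
Qed.

Lemma len_widen w N : (sbound w <= N)%N -> len w = (\sum_(i < N) code w i)%N.
Proof.
move=> le_wN; rewrite /len -!(big_mkord predT) [RHS](big_cat_nat _ le_wN) //=.
rewrite [X in _ = (_ + X)%N]big_nat_cond [X in _ = (_ + X)%N]big1 ?addn0 // => i /andP[/andP[? _] _].
exact: code_ge.
Qed.

Lemma sum_eq_except2 (f g : nat -> nat) i N : (i.+1 < N)%N ->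
    (forall j, j != i -> j != i.+1 -> f j = g j) ->
  (\sum_(j < N) f j + (g i + g i.+1) = \sum_(j < N) g j + (f i + f i.+1))%N.
Proof.
move=> lt_iN eq_fg; elim: N lt_iN => // N IHN.
rewrite ltnS leq_eqVlt => /orP[/eqP <-|lt_iN].
  rewrite !big_ord_recr /= (eq_bigr (fun j : 'I_i => g j)); first by lia.
  by move=> j _; apply: eq_fg; have := ltn_ord j; lia.
have := IHN lt_iN; rewrite !big_ord_recr /= (eq_fg N); lia.
Qed.

(** Two adjacent code entries are exchanged and one of them grows by 1; [N] is a common range for
    both sums. *)
Lemma len_asc w i : (w i < w i.+1)%N -> len (smul w (sgen i)) = (len w).+1.
Proof.
move=> lt_w; pose N := maxn (maxn (sbound w) (sbound (smul w (sgen i)))) i.+2.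
rewrite (@len_widen w N) ?(@len_widen _ N); try by rewrite /N; lia.
have lt_iN : (i.+1 < N)%N by rewrite /N; lia.
have := sum_eq_except2 lt_iN (@code_sgenN w i).
by rewrite code_sgenl // code_sgenr //; lia.
Qed.

Lemma len_desc w i : (w i.+1 < w i)%N -> len w = (len (smul w (sgen i))).+1.
Proof.
by move=> lt_w; rewrite -(@len_asc _ i) ?smul_sgenK // smul_sgenl smul_sgenr.
Qed.

Lemma len_sgen w i : (len (smul w (sgen i)) <= (len w).+1)%N.
Proof.
by case: (asc_or_desc w i) => [/len_asc ->//|/len_desc ->]; rewrite leqW.
Qed.

Lemma code_sid i : code sid i = 0%N.
Proof.
have [le_i|] := leqP (sbound sid) i; first exact: code_ge.
rewrite /sbound big1_seq // => j; rewrite /= /sid /=.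
by rewrite finsupp0 inE.
Qed.

Lemma len_sid : len sid = 0%N.
Proof. by rewrite /len big1 // => i _; apply: code_sid. Qed.

Lemma code_leq_add w k i : (forall i, (k <= i)%N -> (w i < w i.+1)%N) ->
  (k <= i)%N -> forall j, (code w i <= code w (i + j))%N.
Proof.
move=> asc_w le_ki; elim=> [|j IHj]; first by rewrite addn0.
by apply: leq_trans IHj _; rewrite addnS; apply/code_asc/asc_w; lia.
Qed.

(** From [k] on the code is weakly increasing, yet it is eventually 0. *)
Lemma code_asc_ge w k i : (forall i, (k <= i)%N -> (w i < w i.+1)%N) ->
  (k <= i)%N -> code w i = 0%N.
Proof.
move=> asc_w le_ki; have := code_leq_add asc_w le_ki (sbound w).
by rewrite (@code_ge w (i + sbound w)) ?leq_addl // leqn0 => /eqP.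
Qed.

Lemma sid_or_desc w : w = sid \/ exists i, (w i.+1 < w i)%N.
Proof.
have [[i lt_w]|nodesc] := pselect (exists i, (w i.+1 < w i)%N).
  by right; exists i.
left; apply: code_inj => i; rewrite code_sid.
apply: (@code_asc_ge w 0) => // j _; case: (asc_or_desc w j) => // lt_w.
by case: nodesc; exists j.
Qed.

(** Induction on the length, climbing the right weak order. *)
Lemma sinf_ind (P : Sinf -> Prop) : P sid ->
    (forall w i, (w i < w i.+1)%N -> P w -> P (smul w (sgen i))) ->
  forall w, P w.
Proof.
move=> P1 PS w; have [n] := ubnP (len w); elim: n w => // n IHn w lt_wn.
case: (sid_or_desc w) => [-> //|[i lt_w]].
rewrite -(smul_sgenK i w); apply: PS; first by rewrite smul_sgenl smul_sgenr.
by apply: IHn; move: lt_wn; rewrite (len_desc lt_w).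
Qed.

Lemma len_eq0 w : len w = 0%N -> w = sid.
Proof.
by case: (sid_or_desc w) => // -[i /len_desc ->].
Qed.

Lemma word_prod_rcons a i :
  word_prod (rcons a i) = smul (word_prod a) (sgen i).
Proof. by elim: a => [|j a IHa] /=; rewrite ?smul1s ?smuls1 // IHa smulA. Qed.

Lemma len_word_prod a : (len (word_prod a) <= size a)%N.
Proof.
elim/last_ind: a => [|a i IHa]; first by rewrite len_sid.
by rewrite word_prod_rcons size_rcons (leq_trans (len_sgen _ _)).
Qed.

Lemma word_of_len w : exists2 a, word_prod a = w & size a = len w.
Proof.
elim/sinf_ind: w => [|w i lt_w [a aE sa]]; first by exists [::]; rewrite ?len_sid.
exists (rcons a i); first by rewrite word_prod_rcons aE.
by rewrite size_rcons sa len_asc.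
Qed.

Lemma reduced_word_len a w :
  reduced_word a w -> word_prod a = w /\ size a = len w.
Proof.
move=> [aE min_a]; split=> //; have [b bE sb] := word_of_len w.
by have := min_a b bE; have := len_word_prod a; rewrite aE -sb; lia.
Qed.

(** * Skew divided differences *)

Section SkewDividedDifferences.

Variables (R : comNzRingType) (s : nat -> {rmorphism R -> R}).
Variables (d : nat -> R -> R) (x : nat -> R).
Hypothesis calc : dd_calculus s d x.

(** * Independence of the reduced word *)

Lemma word_prod_rcons_inv a w i :
  word_prod (rcons a i) = w -> word_prod a = smul w (sgen i).
Proof. by rewrite word_prod_rcons => <-; rewrite smul_sgenK. Qed.

Lemma reduced_rcons a w i : word_prod (rcons a i) = w -> len w = size (rcons a i) ->
  (w i.+1 < w i)%N /\ len (smul w (sgen i)) = size a.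
Proof.
move=> aE; rewrite size_rcons => lw.
have := len_word_prod a; rewrite (word_prod_rcons_inv aE) => le_a.
case: (asc_or_desc w i) => [/len_asc|lt_w]; first by lia.
by have := len_desc lt_w; split=> //; lia.
Qed.

Lemma smul_sgenC w i j : (i.+1 < j)%N ->
  smul (smul w (sgen i)) (sgen j) = smul (smul w (sgen j)) (sgen i).
Proof. by move=> lt_ij; apply: sinfP => k; rewrite !smul_sgenE swapnC. Qed.

Lemma smul_sgen_braid w i :
  smul (smul (smul w (sgen i)) (sgen i.+1)) (sgen i) =
  smul (smul (smul w (sgen i.+1)) (sgen i)) (sgen i.+1).
Proof. by apply: sinfP => k; rewrite !smul_sgenE swapn_braid. Qed.

(** Matsumoto's argument: if the last letters [i] and [j] differ, both words are compared, by
    induction on the size, with words that end in the two sides of the braid relation between [i]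
    and [j]. *)
Lemma matsumoto_ddword a b f : word_prod a = word_prod b ->
    size a = len (word_prod a) -> size b = len (word_prod a) ->
  foldr d f a = foldr d f b.
Proof.
have [n] := ubnP (size a); elim: n a b f => // n IHn a b f.
case: (lastP a) => [_ _ _|a' i]; first by rewrite /= len_sid => /size0nil ->.
case: (lastP b) => [_ ->|b' j]; first by rewrite /= len_sid size_rcons.
set w := word_prod (rcons a' i) => lt_an bE la lb.
rewrite size_rcons in lt_an.
have [di li] := reduced_rcons (erefl w) (esym la).
have [dj lj] := reduced_rcons (esym bE) (esym lb).
have aE := word_prod_rcons_inv (erefl w).
have {}bE := word_prod_rcons_inv (esym bE).
have IHa c g : word_prod c = smul w (sgen i) -> size c = size a' ->
    foldr d g a' = foldr d g c.
  by move=> cE sc; apply: IHn; rewrite ?aE ?cE ?li //; lia.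
have lab : size a' = size b'.
  by move: la lb; rewrite -/w !size_rcons; lia.
have IHb c g : word_prod c = smul w (sgen j) -> size c = size b' ->
    foldr d g b' = foldr d g c.
  by move=> cE sc; apply: IHn; rewrite ?bE ?cE ?lj //; lia.
rewrite !foldr_rcons.
clearbody w; clear IHn la lb lt_an.
wlog lt_ij : i j a' b' di li dj lj aE bE IHa IHb lab / (i < j)%N.
  move=> wl; case: (ltngtP i j) => [lt_ij|lt_ji|eq_ij].
  - exact: wl.
  - by apply/esym/wl => //.
  - by rewrite -eq_ij in bE IHb *; apply: IHa; rewrite ?bE.
have [lt1_ij|le_ji] := ltnP i.+1 j.
  (* Distant letters: the two words are replaced by [c] followed by [j], [i] and by [i], [j]. *)
  have [c cE sc] := word_of_len (smul (smul w (sgen i)) (sgen j)).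
  have d2 : (smul w (sgen i) j.+1 < smul w (sgen i) j)%N.
    by rewrite !smul_sgenN //; lia.
  have l2 := len_desc d2.
  rewrite (IHa (rcons c j)) ?word_prod_rcons ?size_rcons ?cE ?smul_sgenK //;
    last by lia.
  have cE' : word_prod (rcons c i) = smul w (sgen j).
    by rewrite word_prod_rcons cE (smul_sgenC w lt1_ij) smul_sgenK.
  rewrite (IHb _ _ cE'); last by rewrite size_rcons; lia.
  by rewrite !foldr_rcons (dd_comm calc _ lt1_ij).
have {lt_ij le_ji} jE : j = i.+1 by lia.
subst j; pose w2 := smul (smul w (sgen i)) (sgen i.+1).
have d2 : (smul w (sgen i) i.+2 < smul w (sgen i) i.+1)%N.
  by rewrite smul_sgenr smul_sgenN ?(ltn_trans dj) //; lia.
have d3 : (w2 i.+1 < w2 i)%N.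
  by rewrite smul_sgenl [w2 i]smul_sgenN ?smul_sgenl ?smul_sgenN //; lia.
have l2 := len_desc d2; have l3 := len_desc d3; rewrite -/w2 in l2.
(* Adjacent letters: the two words are replaced by [c] followed by [i], [i.+1], [i] and by [i.+1],
   [i], [i.+1]. *)
have [c cE sc] := word_of_len (smul w2 (sgen i)).
rewrite (IHa (rcons (rcons c i) i.+1)) ?word_prod_rcons ?size_rcons ?cE ?smul_sgenK //;
  last by lia.
have cE' : word_prod (rcons (rcons c i.+1) i) = smul w (sgen i.+1).
  by rewrite !word_prod_rcons cE smul_sgen_braid !smul_sgenK.
rewrite (IHb _ _ cE'); last by rewrite !size_rcons; lia.
by rewrite !foldr_rcons (dd_braid calc).
Qed.

Variable dp : Sinf -> R -> R.
Hypothesis dpE : forall w,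
  exists2 a, reduced_word a w & forall f, dp w f = foldr d f a.

Lemma dpermE a w f : word_prod a = w -> size a = len w -> dp w f = foldr d f a.
Proof.
move=> aE sa; have [b /reduced_word_len[bE sb] ->] := dpE w.
by apply: matsumoto_ddword; rewrite bE ?aE.
Qed.

Lemma dperm_sid f : dp sid f = f.
Proof. by rewrite (@dpermE [::]) ?len_sid. Qed.

Lemma dperm_asc w i f : (w i < w i.+1)%N -> dp (smul w (sgen i)) f = dp w (d i f).
Proof.
move=> lt_w; have [a aE sa] := word_of_len w.
rewrite (dpermE _ aE) // (@dpermE (rcons a i)) ?foldr_rcons //.
  by rewrite word_prod_rcons aE.
by rewrite size_rcons sa len_asc.
Qed.

Lemma dpermD w f g : dp w (f + g) = dp w f + dp w g.
Proof.
elim/sinf_ind: w f g => [|w i lt_w IHw] f g; first by rewrite !dperm_sid.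
by rewrite !dperm_asc // (dd_D calc) IHw.
Qed.

Lemma dperm0 w : dp w 0 = 0.
Proof. by apply: (addIr (dp w 0)); rewrite -dpermD !add0r. Qed.

Lemma dperm_desc w i f : (w i.+1 < w i)%N -> dp w (d i f) = 0.
Proof.
move=> lt_w; rewrite -(smul_sgenK i w) dperm_asc ?(dd_dd calc) ?dperm0 //.
by rewrite smul_sgenl smul_sgenr.
Qed.

(** * Triangularity of the divided differences on Schubert polynomials *)

Variable Sch : Sinf -> R.
Hypothesis Sch1 : Sch sid = 1.
Hypothesis Sch_desc : forall w i, (w i.+1 < w i)%N ->
  d i (Sch w) = Sch (smul w (sgen i)).

Lemma Sch_asc w i : (w i < w i.+1)%N -> d i (Sch w) = 0.
Proof.
move=> lt_w; rewrite -(smul_sgenK i w) -Sch_desc ?(dd_dd calc) //.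
by rewrite smul_sgenl smul_sgenr.
Qed.

(** If [v] is not the identity and the value is nonzero, any descent of [v] is also one of [u],
    hence lies below [sbound u]; removing it from both shortens [u]. *)
Lemma dperm_Sch_support u : exists A : {fset Sinf},
  forall v, v \notin A -> dp v (Sch u) = 0.
Proof.
have [n] := ubnP (len u); elim: n u => // n IHn u lt_un.
have fam i : exists A : {fset Sinf},
    forall v, v \notin A -> dp v (d i (Sch u)) = 0.
  case: (asc_or_desc u i) => lt_u.
    by exists fset0 => v _; rewrite Sch_asc // dperm0.
  rewrite Sch_desc //; apply: IHn; move: lt_un.
  by rewrite (len_desc lt_u).
have [F FE] := choice fam.
exists (sid |` \bigcup_(i <- iota 0 (sbound u)) [fset smul v (sgen i) | v in F i])%fset.
move=> v; rewrite !inE negb_or => /andP[ne_v nv].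
case: (sid_or_desc v) => [v1|[i lt_v]]; first by rewrite v1 eqxx in ne_v.
have asc_v : (smul v (sgen i) i < smul v (sgen i) i.+1)%N.
  by rewrite smul_sgenl smul_sgenr.
rewrite -(smul_sgenK i v) dperm_asc //.
have [lt_iu|le_ui] := ltnP i (sbound u); last first.
  by rewrite Sch_asc ?dperm0 // !sbound_fix //; lia.
apply: FE; apply: contra nv => vF; apply/bigfcupP.
exists i; first by rewrite mem_iota lt_iu.
by rewrite -(smul_sgenK i v); apply: in_imfset.
Qed.

Lemma dperm_Sch_eq0 v u : (len u <= len v)%N -> v != u -> dp v (Sch u) = 0.
Proof.
elim/sinf_ind: v u => [|v i lt_v IHv] u.
  by rewrite len_sid leqn0 => /eqP/len_eq0 ->; rewrite eqxx.
rewrite len_asc // dperm_asc // => le_uv ne_vu.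
case: (asc_or_desc u i) => lt_u; first by rewrite Sch_asc ?dperm0.
rewrite Sch_desc //; apply: IHv.
  by move: le_uv; rewrite (len_desc lt_u).
by apply: contra ne_vu => /eqP ->; rewrite smul_sgenK.
Qed.

Lemma dperm_Sch_diag u : dp u (Sch u) = 1.
Proof.
elim/sinf_ind: u => [|u i lt_u IHu]; first by rewrite dperm_sid Sch1.
by rewrite dperm_asc // Sch_desc ?smul_sgenK // smul_sgenl smul_sgenr.
Qed.

(** The matrix of the [dp v (Sch u)] is unitriangular for the length, so evaluation at [Sch u]
    isolates the coefficient at [u] once those of smaller length agree. *)
Lemma dperm_free (a b : Sinf -> R) :
    (forall u, exists2 A : {fset Sinf}, (forall v, v \notin A -> dp v (Sch u) = 0) &
       \sum_(v <- A) a v * dp v (Sch u) = \sum_(v <- A) b v * dp v (Sch u)) ->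
  a =1 b.
Proof.
move=> eq_ab u; have [n] := ubnP (len u); elim: n u => // n IHn u lt_un.
have [A A0] := eq_ab u.
have uA : u \in A.
  by apply/contraT => /A0/eqP; rewrite dperm_Sch_diag oner_eq0.
rewrite !(big_fsetD1 _ uA) /= dperm_Sch_diag !mulr1.
rewrite (eq_big_seq (fun v => b v * dp v (Sch u))).
  exact: addIr.
move=> v; rewrite !inE => /andP[ne_vu _].
have [lt_vu|le_uv] := ltnP (len v) (len u); first by rewrite IHn //; lia.
by rewrite dperm_Sch_eq0 ?mulr0.
Qed.

(** * Recursion and product rule for the skew operators *)

Variable D : Sinf -> Sinf -> R -> R.
(** The sum over the infinite group is replaced by a sum over any finite set outside which all terms
    vanish. *)
Hypothesis skewE : forall w f g (A : {fset Sinf}),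
    (forall v, v \notin A -> D w v f * dp v g = 0) ->
  dp w (f * g) = \sum_(v <- A) D w v f * dp v g.

Lemma skew_sid v f : D sid v f = if v == sid then f else 0.
Proof.
move: v; apply: dperm_free => u; have [A A0] := dperm_Sch_support u.
exists (sid |` A)%fset => [v|].
  by rewrite !inE negb_or => /andP[_ /A0].
have s1 : sid \in (sid |` A)%fset by rewrite !inE eqxx.
rewrite -skewE => [|v]; last by rewrite !inE negb_or => /andP[_ /A0 ->]; rewrite mulr0.
rewrite (big_fsetD1 _ s1) /= eqxx big1_fset ?addr0 ?dperm_sid // => v.
by rewrite !inE => /andP[/negPf -> _] _; rewrite mul0r.
Qed.

Lemma skew0 w v : D w v 0 = 0.
Proof.
move: v; apply: (@dperm_free _ (fun=> 0)) => u.
have [A A0] := dperm_Sch_support u; exists A => //.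
rewrite -skewE => [|v /A0 ->]; last by rewrite mulr0.
by rewrite mul0r dperm0 big1 // => v _; rewrite mul0r.
Qed.

(** The coefficient of $\partial_v g$ in $\partial_w\partial_j(fg)$, read off from the twisted
    Leibniz rule for $\partial_j$. *)
Definition skew_step j w v f : R :=
  D w v (d j f) +
  if (v j.+1 < v j)%N then D w (smul v (sgen j)) (s j f) else 0.

Lemma skew_stepE j w f g (A : {fset Sinf}) :
    (forall v, v \notin A -> dp v g = 0) ->
  dp w (d j (f * g)) = \sum_(v <- A) skew_step j w v f * dp v g.
Proof.
move=> A0; rewrite (dd_M calc) dpermD.
rewrite (@skewE _ _ _ A) => [|v /A0 ->]; last by rewrite mulr0.
(* The second Leibniz term is reindexed by $v \mapsto vs_j$, since $\partial_{vs_j}\partial_j$ is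
   $\partial_v$ if [v] descends at [j] and 0 otherwise. *)
rewrite (@skewE _ _ _ [fset smul v (sgen j) | v in A]%fset) => [|v nv]; last first.
  case: (asc_or_desc v j) => lt_v; last by rewrite dperm_desc ?mulr0.
  rewrite -dperm_asc // A0 ?mulr0 //; apply: contra nv => vA.
  by rewrite -(smul_sgenK j v); apply: in_imfset.
rewrite big_imfset /=; last first.
  by move=> v v' _ _ /(congr1 (fun z => smul z (sgen j))); rewrite !smul_sgenK.
rewrite -big_split /=; apply: eq_bigr => v _; rewrite mulrDl; congr (_ + _).
case: ltnP => [lt_v|le_v].
  by rewrite -dperm_asc ?smul_sgenK // smul_sgenl smul_sgenr.
rewrite mul0r dperm_desc ?mulr0 // smul_sgenl smul_sgenr.
by have := @sinf_neq v j j.+1; lia.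
Qed.

Lemma skew_asc j w v f : (w j < w j.+1)%N ->
  D (smul w (sgen j)) v f = skew_step j w v f.
Proof.
move=> lt_w; move: v; apply: dperm_free => u.
have [A A0] := dperm_Sch_support u; exists A => //.
rewrite -skew_stepE // -skewE => [|v /A0 ->]; last by rewrite mulr0.
by rewrite dperm_asc.
Qed.

(** At a descent $\partial_w\partial_j = 0$, so all coefficients of its expansion vanish. *)
Lemma skew_desc j w v f : (w j.+1 < w j)%N -> skew_step j w v f = 0.
Proof.
move=> lt_w; move: v; apply: (@dperm_free _ (fun=> 0)) => u.
have [A A0] := dperm_Sch_support u; exists A => //.
by rewrite -skew_stepE // dperm_desc // big1 // => v _; rewrite mul0r.
Qed.

Lemma skew_support w : exists A : {fset Sinf},
  forall v f, v \notin A -> D w v f = 0.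
Proof.
elim/sinf_ind: w => [|w j lt_w [A A0]].
  by exists [fset sid]%fset => v f; rewrite skew_sid inE => /negPf ->.
exists (A `|` [fset smul v (sgen j) | v in A])%fset => v f.
rewrite inE negb_or => /andP[nv nv'].
rewrite skew_asc // /skew_step A0 // add0r; case: ifP => // _; apply: A0.
apply: contra nv' => vA; rewrite -(smul_sgenK j v); exact: in_imfset.
Qed.

(** Both sides are coefficients of $\partial_v h$ in $\partial_w(fgh)$, expanded along $(fg)h$ and
    along $f(gh)$. *)
Lemma skewM w f g : exists A : {fset Sinf}, forall v,
  D w v (f * g) = \sum_(z <- A) D w z f * D z v g.
Proof.
have [L L0] := skew_support w; exists L; apply: dperm_free => u.
have [A A0] := dperm_Sch_support u; exists A => //.
rewrite -skewE => [|v /A0 ->]; last by rewrite mulr0.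
rewrite -mulrA (@skewE _ _ _ L) => [|v /L0 ->]; last by rewrite mul0r.
under eq_bigr => z _.
  rewrite (@skewE _ _ _ A) => [|v /A0 ->]; last by rewrite mulr0.
  rewrite mulr_sumr; over.
rewrite exchange_big /=; apply: eq_bigr => v _; rewrite mulr_suml.
by apply: eq_bigr => z _; rewrite mulrA.
Qed.

(** * Dominant permutations *)

Definition mon (l : nat -> nat) n : R := \prod_(i < n) x i ^+ l i.

Lemma monS l n : mon l n.+1 = mon l n * x n ^+ l n.
Proof. by rewrite /mon big_ord_recr. Qed.

Lemma mon_widen l k n : (forall i, (k <= i)%N -> l i = 0%N) -> (k <= n)%N ->
  mon l n = mon l k.
Proof.
move=> l0; elim: n => [|n IHn]; first by rewrite leqn0 => /eqP ->.
rewrite leq_eqVlt => /orP[/eqP -> //|le_kn].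
by rewrite monS IHn // l0 // expr0 mulr1.
Qed.

Lemma mulx_mon l n j : (j < n)%N ->
  x j * mon l n = mon (fun i => l i + (i == j))%N n.
Proof.
move=> lt_jn; rewrite /mon (bigD1 (Ordinal lt_jn)) //=.
rewrite [RHS](bigD1 (Ordinal lt_jn)) //= eqxx addn1 exprS mulrA; congr (_ * _).
by apply: eq_bigr => i; rewrite -val_eqE /= => /negPf ->; rewrite addn0.
Qed.

(** The condition [j.+1 != n] says that the product runs over both or neither of the indices [j] and
    [j.+1]. *)
Lemma s_mon l j n : l j = l j.+1 -> j.+1 != n -> s j (mon l n) = mon l n.
Proof.
move=> eq_l; have small m : (m <= j)%N -> s j (mon l m) = mon l m.
  elim: m => [|m IHm] le_mj; first by rewrite /mon big_ord0 rmorph1.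
  by rewrite monS rmorphM rmorphXn /= IHm 1?ltnW // (sx_N calc) //; lia.
elim: n => [|n IHn] ne_jn; first exact: small.
have [->|ne_jn'] := eqVneq n j.+1.
  rewrite !monS !rmorphM !rmorphXn /= small // (sx_l calc) (sx_r calc) eq_l.
  by rewrite mulrAC.
by rewrite monS rmorphM rmorphXn /= IHn 1?eq_sym // (sx_N calc) //; lia.
Qed.

Hypothesis Sch_slong : forall n, Sch (slong n) = mon (fun i => n.-1 - i)%N n.

Lemma code_slong n i : code (slong n) i = (n.-1 - i)%N.
Proof.
have slongE j : slong n j = if (j < n)%N then (n.-1 - j)%N else j.
  exact: slong_funE.
have [lt_in|le_ni] := ltnP i n; last first.
  rewrite (@code_asc_ge _ n) //; first by lia.
  by move=> j le_nj; rewrite !slongE; case: (ltnP j n); case: (ltnP j.+1 n); lia.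
rewrite /code slongE lt_in.
suff -> : nlow (slong n) i (n.-1 - i) = 0%N by rewrite subn0.
apply/eqP; rewrite -leqn0 leqNgt -has_count; apply/hasPn => j.
by rewrite mem_iota slongE => ?; case: ifP; lia.
Qed.

(** Without equal neighbours, [l] would drop at every step and stay strictly below the staircase
    forever, which is impossible. The least equal pair with room to grow is a corner. *)
Lemma dominant_corner (l : nat -> nat) n : (forall i, l i.+1 <= l i)%N ->
    (exists i, l i < n.-1 - i)%N ->
  exists j, [/\ l j = l j.+1, (l j < n.-1 - j)%N &
    forall i, i.+1 = j -> (l j < l i)%N].
Proof.
move=> dec_l [i lt_i].
have exP : exists j, (l j == l j.+1) && (l j < n.-1 - j)%N.
  apply: contrapT => noj; have strict t : (l (i + t) < n.-1 - (i + t))%N.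
    elim: t => [|t IHt]; first by rewrite addn0.
    have ne_l : l (i + t)%N != l (i + t).+1.
      by apply/negP => eq_l; apply: noj; exists (i + t)%N; rewrite eq_l.
    by have := dec_l (i + t)%N; rewrite addnS; lia.
  by have := strict n; lia.
case: (ex_minnP exP) => j /andP[/eqP eq_j lt_j] min_j; exists j; split=> //.
move=> k kj; rewrite ltnNge; apply/negP => le_kj.
have := min_j k; have := dec_l k; rewrite kj => dec_k.
have -> : l k == l j by rewrite eqn_leq le_kj dec_k.
by move=> /(_ ltac:(lia)); lia.
Qed.

(* Adding a box to an outer corner of the code that lies
   in the first of two equal rows inverts a divided difference. *)
Lemma Sch_dominant n (l : nat -> nat) :
    (forall i, l i.+1 <= l i)%N -> (forall i, l i <= n.-1 - i)%N ->
  exists2 u, code u =1 l & Sch u = mon l n.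
Proof.
(* Induction on the number of boxes missing from the staircase, the code of [slong n]. *)
have [m] := ubnP (\sum_(i < n) (n.-1 - i - l i))%N.
elim: m l => // m IHm l lt_m dec_l le_l.
have [lt_l|ge_l] := pselect (exists i, l i < n.-1 - i)%N; last first.
  have lE i : l i = (n.-1 - i)%N.
    apply/eqP; rewrite eqn_leq le_l leqNgt; apply/negP => lt_i.
    by apply: ge_l; exists i.
  exists (slong n) => [i|]; first by rewrite code_slong lE.
  by rewrite Sch_slong; apply: eq_bigr => i _; rewrite lE.
have [j [eq_j lt_j corner_j]] := dominant_corner dec_l lt_l.
have lt_jn : (j < n)%N by lia.
pose l' i := (l i + (i == j))%N.
have [||i|u' cu' Su'] := IHm l'.
- rewrite -ltnS; apply: leq_trans lt_m; rewrite ltnS (bigD1 (Ordinal lt_jn)) //=.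
  rewrite [X in (_ < X)%N](bigD1 (Ordinal lt_jn)) //= /l' eqxx.
  rewrite (eq_bigr (fun i : 'I_n => n.-1 - i - l i)%N); first by lia.
  by move=> i; rewrite -val_eqE /= => /negPf ->; rewrite addn0.
- move=> i; rewrite /l'; case: eqP => [ij|_]; first by have := corner_j i ij; rewrite ij; lia.
  by have := dec_l i; lia.
- by rewrite /l'; case: eqP => [->|_]; have := le_l i; lia.
have desc_j : (u' j.+1 < u' j)%N.
  case: (asc_or_desc u' j) => // /code_asc.
  by rewrite !cu' /l' eqxx gtn_eqF // eq_j; lia.
pose u := smul u' (sgen j).
have asc_j : (u j < u j.+1)%N by rewrite /u smul_sgenl smul_sgenr.
have u'E : u' = smul u (sgen j) by rewrite smul_sgenK.
exists u => [i|].
  have [->|ne_ij] := eqVneq i j.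
    by rewrite -(code_sgenr asc_j) -u'E cu' /l' gtn_eqF // addn0.
  have [->|ne_ij1] := eqVneq i j.+1.
    apply/eqP; rewrite -eqSS -(code_sgenl asc_j) -u'E cu' /l' eqxx addn1 eq_j.
    by [].
  by rewrite code_sgenN // cu' /l' (negPf ne_ij) addn0.
(* As [l j = l j.+1], [s j] fixes [mon l n], so [d j] sends [x j * mon l n] to [mon l n]. *)
rewrite -Sch_desc // Su' -mulx_mon // (dd_M calc) (dd_xl calc) mul1r.
by rewrite [d j _](dd_sym calc) ?mulr0 ?addr0 // s_mon //; lia.
Qed.

(** * Nonnegativity *)

(** An abstract form of coefficientwise nonnegativity. *)
Variable nn : R -> Prop.
Hypotheses (nn0 : nn 0) (nn1 : nn 1) (nnx : forall i, nn (x i)).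
Hypothesis nnD : forall f g, nn f -> nn g -> nn (f + g).
Hypothesis nnM : forall f g, nn f -> nn g -> nn (f * g).

Lemma skew1_ge0 w v : nn (D w v 1).
Proof.
elim/sinf_ind: w v => [|w j lt_w IHw] v.
  by rewrite skew_sid; case: ifP.
rewrite skew_asc // /skew_step (dd_sym calc) ?rmorph1 // skew0 add0r.
by case: ifP.
Qed.

(* By Monk's rule the negative terms of $D_{w/v}(x_i)$ come from
   $w = v t_{li}$ with $l < i$, and then $w(l) > w(i)$. *)
Lemma skew_x_ge0 w v i : (forall l, l < i -> w l < w i)%N -> nn (D w v (x i)).
Proof.
elim/sinf_ind: w v i => [|w j lt_w IHw] v i lt_i.
  by rewrite skew_sid; case: ifP.
(* This excludes the one negative contribution, $\partial_j x_{j+1} = -1$. *)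
have ne_ji : j.+1 != i.
  apply/eqP => ji; have := lt_i j; rewrite -ji smul_sgenl smul_sgenr.
  by move=> /(_ (ltnSn j)); lia.
(* For [i = j] the reflection turns [x j] into [x j.+1], and the induction hypothesis is used at
   [j.+1]. *)
rewrite skew_asc // /skew_step; have [ji|ne_ij] := eqVneq i j.
  rewrite ji in lt_i *; rewrite (dd_xl calc) (sx_l calc).
  apply: nnD; first exact: skew1_ge0.
  case: ifP => // _; apply: IHw => l.
  rewrite ltnS leq_eqVlt => /orP[/eqP -> //|lt_lj].
  by have := lt_i l lt_lj; rewrite smul_sgenl smul_sgenN //; lia.
have sx : s j (x i) = x i by rewrite (sx_N calc) // eq_sym.
rewrite (dd_sym calc sx) skew0 add0r sx; case: ifP => // _; apply: IHw => l lt_li.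
rewrite -(@smul_sgenN w j i) // 1?eq_sym //.
have [lj|ne_lj] := eqVneq l j.
  by rewrite lj -(smul_sgenr w j) lt_i //; lia.
have [lj|ne_lj1] := eqVneq l j.+1.
  by rewrite lj -(smul_sgenl w j) lt_i //; lia.
by rewrite -(@smul_sgenN w j l) // lt_i.
Qed.

(** The recursion read backwards: its second term is absent when [v] ascends at [j]. *)
Lemma skew_dd_asc w v j f : (v j < v j.+1)%N ->
  D w v (d j f) =
  if (w j < w j.+1)%N then D (smul w (sgen j)) v f else 0.
Proof.
move=> lt_v; have stepE : skew_step j w v f = D w v (d j f).
  by rewrite /skew_step ltnNge ltnW // addr0.
case: (asc_or_desc w j) => lt_w; first by rewrite lt_w skew_asc.
by rewrite ltnNge ltnW //= -stepE skew_desc.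
Qed.

(** Here $D_{w/v} f = D_{ws_j/v}(\partial_j f)$, and $\partial_j f = 0$. *)
Lemma skew_sym_desc w v j f : s j f = f -> (v j < v j.+1)%N ->
  (w j.+1 < w j)%N -> D w v f = 0.
Proof.
move=> sf lt_v lt_w; have lt_w' : (smul w (sgen j) j < smul w (sgen j) j.+1)%N.
  by rewrite smul_sgenl smul_sgenr.
have := skew_dd_asc (smul w (sgen j)) f lt_v.
by rewrite lt_w' smul_sgenK (dd_sym calc sf) skew0.
Qed.

(** A descent at the 1-based position [k] itself is allowed, in accordance with $k \le
    \mathrm{mindes}(v)$. *)
Definition increasing_below k w := forall i, (i.+1 < k)%N -> (w i < w i.+1)%N.

Lemma increasing_belowP k w :
  increasing_below k w \/ exists2 i, (i.+1 < k)%N & (w i.+1 < w i)%N.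
Proof.
have [des|nodes] := pselect (exists2 i, (i.+1 < k)%N & (w i.+1 < w i)%N).
  by right.
left=> i lt_ik; case: (asc_or_desc w i) => // lt_w; case: nodes; by exists i.
Qed.

Lemma increasing_below_lt k w l i : increasing_below k w ->
  (l < i)%N -> (i < k)%N -> (w l < w i)%N.
Proof.
move=> inc_w; elim: i => // i IHi; rewrite ltnS leq_eqVlt.
case/orP => [/eqP ->|lt_li] lt_ik; first exact: inc_w.
by apply: ltn_trans (IHi lt_li _) (inc_w _ lt_ik); apply: ltnW.
Qed.

Definition skew_ge0_below k f :=
  forall v, increasing_below k v -> forall w, nn (D w v f).

(** In the matrix product, an intermediate [z] with a descent below [k] contributes 0, by the
    symmetry of [g]; for the others both factors are nonnegative. *)
Lemma skew_ge0_belowM k f g :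
    skew_ge0_below k f -> skew_ge0_below k g ->
    (forall i, (i.+1 < k)%N -> s i g = g) ->
  skew_ge0_below k (f * g).
Proof.
move=> Pf Pg sg v inc_v w; have [A ->] := skewM w f g.
apply: (big_ind nn) => // z _.
case: (increasing_belowP k z) => [inc_z|[i lt_ik lt_z]].
  by apply: nnM; [apply: Pf | apply: Pg].
by rewrite [D z v g](@skew_sym_desc _ _ i) ?mulr0 //; [apply: sg | apply: inc_v].
Qed.

Lemma skew_ge0_below_dd k f i : (i.+1 < k)%N ->
  skew_ge0_below k f -> skew_ge0_below k (d i f).
Proof.
move=> lt_ik Pf v inc_v w; rewrite skew_dd_asc; last exact: inc_v.
by case: ifP => // _; apply: Pf.
Qed.

Lemma skew_ge0_belowS k f : skew_ge0_below k f -> skew_ge0_below k.+1 f.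
Proof. by move=> Pf v inc_v; apply: Pf => i /ltnW; apply: inc_v. Qed.

(* Multiplying $x_1 \cdots x_k$ by $x_{k+1}$ creates no negative term at a [w]
   increasing on the first $k + 1$ positions; at the other [w] the coefficient
   vanishes by symmetry. *)
Lemma skew_ge0_below_elem k : skew_ge0_below k (mon (fun=> 1%N) k).
Proof.
elim: k => [|k IHk] v inc_v w; first by rewrite /mon big_ord0; apply: skew1_ge0.
case: (increasing_belowP k.+1 w) => [inc_w|[i lt_ik lt_w]]; last first.
  rewrite (@skew_sym_desc _ _ i) //; last exact: inc_v.
  by rewrite s_mon //; lia.
rewrite monS expr1 mulrC; have [A ->] := skewM w (x k) (mon (fun=> 1%N) k).
apply: (big_ind nn) => // z _; apply: nnM.
  by apply: skew_x_ge0 => l lt_lk; apply: (increasing_below_lt inc_w).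
by apply: IHk => i /ltnW; apply: inc_v.
Qed.

(** The power [l k] of the product of the first [k.+1] variables is split off. Its base is
    symmetric, so the product rule absorbs it one factor at a time; the rest involves only [k]
    variables. *)
Lemma skew_ge0_below_mon k l : (forall i, i.+1 < k -> l i.+1 <= l i)%N ->
  skew_ge0_below k (mon l k).
Proof.
elim: k l => [|k IHk] l dec_l.
  by move=> v _ w; rewrite /mon big_ord0; apply: skew1_ge0.
have le_l i : (i < k)%N -> (l k <= l i)%N.
  move=> lt_ik; have [t kE] : exists t, k = (i + t)%N by exists (k - i)%N; lia.
  have le_t m : (m <= t)%N -> (l (i + m) <= l i)%N.
    elim: m => [|m IHm] lt_mt; first by rewrite addn0.
    rewrite addnS; apply: leq_trans (IHm (ltnW lt_mt)); apply: dec_l; lia.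
  by rewrite [in l k]kE le_t.
have -> : mon l k.+1 =
    mon (fun i => l i - l k)%N k * mon (fun=> 1%N) k.+1 ^+ l k.
  rewrite !monS expr1 exprMn mulrA; congr (_ * _).
  rewrite /mon -prodrXl -big_split /=; apply: eq_bigr => i _.
  by rewrite expr1 -exprD subnK // le_l.
have : skew_ge0_below k.+1 (mon (fun i => l i - l k)%N k).
  apply/skew_ge0_belowS/IHk => i lt_ik; apply: leq_sub2r; apply: dec_l; lia.
elim: (l k) (mon _ k) => [|n IHn] f Pf; first by rewrite expr0 mulr1.
rewrite exprS mulrA; apply: IHn; apply: skew_ge0_belowM => //.
  exact: skew_ge0_below_elem.
by move=> i lt_ik; rewrite s_mon //; lia.
Qed.

(** Turning an ascent of [u] before [k] into a descent lowers the sum of the [i * u i], and a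
    divided difference leads back to [u]. When no such ascent is left, the code is weakly
    decreasing. *)
Lemma skew_ge0_below_Sch k u : (forall i, (k <= i)%N -> (u i < u i.+1)%N) ->
  skew_ge0_below k (Sch u).
Proof.
have [n] := ubnP (\sum_(i < k) i * u i)%N.
elim: n u => // n IHn u lt_n asc_u.
have [[i lt_ik lt_u]|noasc] :=
  pselect (exists2 i, (i.+1 < k)%N & (u i < u i.+1)%N).
  rewrite -(smul_sgenK i u) -Sch_desc; last by rewrite smul_sgenl smul_sgenr.
  apply: skew_ge0_below_dd => //; apply: IHn => [|j le_kj].
    have := @sum_eq_except2 (fun l => l * smul u (sgen i) l)%N
      (fun l => l * u l)%N i k lt_ik.
    rewrite smul_sgenl smul_sgenr => E.
    rewrite -ltnS; apply: leq_trans lt_n; rewrite ltnS.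
    have {}E := E (fun j n1 n2 => congr1 (muln j) (smul_sgenN u n1 n2)).
    have : (i * u i.+1 + i.+1 * u i < i * u i + i.+1 * u i.+1)%N by nia.
    by lia.
  by rewrite !smul_sgenN ?asc_u //; lia.
have code0 i : (k <= i)%N -> code u i = 0%N by exact: code_asc_ge.
have dec_c i : (code u i.+1 <= code u i)%N.
  have [lt_ik|le_ki] := ltnP i.+1 k; last by rewrite code0.
  case: (asc_or_desc u i) => [lt_u|/code_desc/ltnW //].
  by case: noasc; exists i.
have le_c i : (code u i <= code u 0)%N.
  by elim: i => // i; apply: leq_trans.
(* Large enough for the code, bounded by [code u 0] and zero from [k] on, to fit under the
   staircase. *)
pose N := (code u 0 + k).+1.
have le_cN i : (code u i <= N.-1 - i)%N.
  have [lt_ik|le_ki] := ltnP i k; last by rewrite code0.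
  by have := le_c i; rewrite /N /=; lia.
have [u' /code_inj -> ->] := Sch_dominant dec_c le_cN.
rewrite (@mon_widen _ k) //; last by rewrite /N; lia.
exact: skew_ge0_below_mon.
Qed.

End SkewDividedDifferences.


(** * Specialization to integer polynomials, and conditions on descents *)

Lemma staircase_prod (R : comNzRingType) (x : nat -> R) n :
  \prod_(i < n) \prod_(j < n | (i.+1 + j.+1 <= n)%N) x i =
  mon x (fun i => n.-1 - i)%N n.
Proof.
apply: eq_bigr => i _; have lt_in := ltn_ord i.
rewrite -(big_mkord (fun j => i.+1 + j.+1 <= n)%N (fun=> x i)).
rewrite -[X in _ = x i ^+ X]subn0 -prodr_const_nat.
rewrite [RHS](@big_nat_widen _ _ _ _ _ n) /=; last by lia.
by rewrite big_nat_cond [RHS]big_nat_cond; apply: eq_bigl => j; lia.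
Qed.

Definition coef_ge0 (f : polyZ) : Prop := forall m : {cmonom nat}, 0 <= f@_m.

Lemma coef_ge00 : coef_ge0 0.
Proof. by move=> m; rewrite mcoeff0. Qed.

Lemma coef_ge01 : coef_ge0 1.
Proof. by move=> m; rewrite mcoeff1 ler0n. Qed.

Lemma coef_ge0_var i : coef_ge0 'x_i.
Proof. by move=> m; rewrite pvarE mcoeffU1 ler0n. Qed.

Lemma coef_ge0D f g : coef_ge0 f -> coef_ge0 g -> coef_ge0 (f + g).
Proof. by move=> f0 g0 m; rewrite mcoeffD addr_ge0. Qed.

Lemma coef_ge0M f g : coef_ge0 f -> coef_ge0 g -> coef_ge0 (f * g).
Proof.
move=> f0 g0 m; rewrite mcoeffMl; apply: sumr_ge0 => m1 _.
by apply: sumr_ge0 => m2 _; rewrite mulrn_wge0 // mulr_ge0.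
Qed.

Lemma ddpermE w :
  exists2 a, reduced_word a w & forall f, ddperm w f = foldr ddiff f a.
Proof. by rewrite /ddperm; case: cid => a aw; exists a. Qed.

Lemma skew_ddiffE (D : Sinf -> Sinf -> {linear polyZ -> polyZ}) :
    is_skew_ddiff D ->
  forall w f g (A : {fset Sinf}),
    (forall v, v \notin A -> D w v f * ddperm v g = 0) ->
  ddperm w (f * g) = \sum_(v <- A) D w v f * ddperm v g.
Proof. by move=> hD w f g A A0; rewrite hD; apply: fsbigTE. Qed.

Lemma Sch_slongE (Sch : Sinf -> polyZ) : is_schubert Sch ->
  forall n, Sch (slong n) = mon pvar (fun i => n.-1 - i)%N n.
Proof. by case=> + _ n => ->; apply: staircase_prod. Qed.

Lemma Sch_sid (Sch : Sinf -> polyZ) : is_schubert Sch -> Sch sid = 1.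
Proof.
move=> hS; suff -> : sid = slong 0 by rewrite (Sch_slongE hS) /mon big_ord0.
by apply: code_inj => i; rewrite code_sid code_slong.
Qed.

(** A descent between the indices [i] and [i.+1] is recorded as [i.+1], so [k <= i] already excludes
    it. *)
Lemma asc_of_maxdes u k i : (maxdes u <= k)%N -> (k <= i)%N -> (u i < u i.+1)%N.
Proof.
move=> le_k le_ki; case: (asc_or_desc u i) => // lt_u.
have : (i.+1 <= maxdes u)%N.
  by apply: (@leq_bigmax_seq _ (descents u) xpredT id) => //; rewrite mem_descents.
by lia.
Qed.

(** As [descents v] is sorted, its head, and hence [k], is at most any recorded descent [i.+1]. *)
Lemma asc_of_mindes v k i : le_mindes k v -> (i.+1 < k)%N -> (v i < v i.+1)%N.
Proof.
move=> le_k lt_ik; case: (asc_or_desc v i) => // lt_v.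
have iv : i.+1 \in descents v by rewrite mem_descents.
have : sorted leq (descents v).
  rewrite sorted_map; apply: sorted_filter (iota_sorted 0 _).
  by move=> b a c; apply: leq_trans.
move: iv le_k; rewrite /le_mindes /mindes; case: (descents v) => //= e t.
rewrite inE => /orP[/eqP <-|it] le_ke; first by lia.
by rewrite path_sortedE //; [move=> /andP[/allP/(_ _ it)]; lia | exact: leq_trans].
Qed.

Theorem corollary6p6
    (Sch : Sinf -> polyZ) (D : Sinf -> Sinf -> {linear polyZ -> polyZ})
    (hS : is_schubert Sch) (hD : is_skew_ddiff D)
    (u v w : Sinf) (huv : separated_descents u v) :
  forall m : {cmonom nat}, 0 <= (D w v (Sch u))@_m.
Proof.
have [k [le_uk le_kv]] := huv.
apply: (skew_ge0_below_Sch polyZ_dd_calculus ddpermE (Sch_sid hS) hS.2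
  (skew_ddiffE hD) (Sch_slongE hS) coef_ge00 coef_ge01 coef_ge0_var coef_ge0D coef_ge0M).
  by move=> i; apply: asc_of_maxdes le_uk.
by move=> i; apply: asc_of_mindes.
Qed.
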